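(* Let $k \geq 2$ be an integer and let $\{t_n\}_{n\geq 0}$ be the $2k$-nacci sequence. Then for all $n \geq 0$ $$ \nu_2(t_n) = \begin{cases} 0 & \text{ for } n \equiv 1,2,\ldots,2k \pmod{2k+1}, \\ 1 & \text{ for } n \equiv 2k+1 \pmod{2(2k+1)}, \\ \nu_2(n) + \nu_2(k-1) + 2 & \text{ for } n \equiv 0 \pmod{2(2k+1)}. \end{cases} $$
   Context: The $2k$-nacci sequence $\{t_n\}_{n\geq 0}$ is defined by $t_0 = 0$, $t_n = 1$ for $1 \leq n \leq 2k-1$, and $t_n = \sum_{i=1}^{2k} t_{n-i}$ for $n \geq 2k$. For a non-zero integer $s$, $\nu_2(s) = \max\{l \geq 0 : 2^l \mid s\}$, and $\nu_2(0) = \infty$. *)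

(* Defs.v *)
From mathcomp Require Import all_boot all_order all_algebra.
From mathcomp Require Import constructive_ereal.

Set Implicit Arguments.
Unset Strict Implicit.
Unset Printing Implicit Defensive.

Import Order.TTheory GRing.Theory Num.Theory.
Local Open Scope ring_scope.

(* The terms t_n, ..., t_1, t_0 of the 2k-nacci sequence, latest first. *)
Fixpoint nacci_hist (k n : nat) : seq nat :=
  if n is m.+1 then
    let s := nacci_hist k m in
    (if (n <= 2 * k - 1)%N then 1%N else sumn (take (2 * k) s)) :: s
  else [:: 0%N].

Definition nacci (k n : nat) : nat := head 0%N (nacci_hist k n).

Lemma nacci_histE k n :
  nacci_hist k n = [seq nacci k (n - i) | i <- iota 0 n.+1].
Proof.
elim: n => [|n IHn]; first by [].
rewrite -[iota 0 n.+2]/(0%N :: iota (1 + 0) n.+1) iotaDl map_cons -map_comp subn0.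
rewrite [LHS]/= IHn /nacci /= IHn; congr (_ :: _).
Qed.

Lemma nacci0 k : nacci k 0 = 0%N.
Proof. by []. Qed.

Lemma nacci1 k n : (1 <= n <= 2 * k - 1)%N -> nacci k n = 1%N.
Proof. by case: n => // n /= le_n; rewrite /nacci /= le_n. Qed.

Lemma nacci_rec k n : (1 <= k)%N -> (2 * k <= n)%N ->
  nacci k n = (\sum_(1 <= i < (2 * k).+1) nacci k (n - i))%N.
Proof.
case: n => [|n] k_gt0 le_kn; first by rewrite leqNgt muln_gt0 k_gt0 in le_kn.
have k2_gt0 : (0 < 2 * k)%N by rewrite muln_gt0.
rewrite /nacci [LHS]/= ifF; last first.
  by apply/negbTE; rewrite -ltnNge subn1 prednK.
rewrite nacci_histE -map_take take_iota (minn_idPl le_kn) sumnE big_map.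
rewrite big_add1 /= /index_iota subn0.
by apply: eq_bigr => i _; rewrite subSS.
Qed.

(* Extended values, since the valuation of 0 is +oo. *)
Definition nu2 (s : int) : \bar int :=
  if s == 0 then +oo%E else (logn 2 `|s|%N)%:Z%:E.

Lemma nu2P (s : int) (l : nat) : s != 0 ->
  nu2 s = l%:Z%:E <->
  ((2 ^+ l)%R %| s)%Z /\ forall m : nat, ((2 ^+ m)%R %| s)%Z -> (m <= l)%N.
Proof.
move=> s0; rewrite /nu2 (negbTE s0).
have dvdE m : ((2 ^+ m)%R %| s)%Z = (m <= logn 2 `|s|%N)%N.
  by rewrite dvdzE abszX pfactor_dvdn // absz_gt0.
split=> [[<-]|[]].
  by split=> [|m]; rewrite dvdE.
rewrite dvdE => le_l max_l; congr (_%:Z%:E); apply/eqP.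
by rewrite eqn_leq le_l max_l ?dvdE.
Qed.

(* Main.v *)
Require Import Defs.
From mathcomp Require Import all_boot all_order all_algebra.
From mathcomp Require Import constructive_ereal.
From mathcomp Require Import zify ring.

Set Implicit Arguments.
Unset Strict Implicit.
Unset Printing Implicit Defensive.

Import GRing.Theory.

(** Put [N = 2k+1].  Subtracting two consecutive instances of the defining
    recurrence gives [t_{n+N} = 2 t_{n+2k} - t_n].  In terms of the shift [x]
    acting on sequences this reads [x^N = 2 x^{2k} - 1], so that
    [x^{rN} = (2 x^{2k} - 1)^r], and also, with [y = x^{-1}], [y^N = 2 y - 1]
    and [y^{rN} = (2 y - 1)^r].  Both expansions are instances of
    [iterated_rec].  They are used 2-adically: when [2^q] divides [r], the
    coefficient [C(r, i) 2^i] is divisible by [2^(q+c)] as soon as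
    [v_2(i) + c <= i] ([dvdn_exp2_bin]).

    The forward expansion shows that shifting by [rN] multiplies [t] by
    [(-1)^r] modulo [2^(q+1)] ([nacci_iter_congr]).  With [q = 0] this settles
    the odd terms, and with [q = 1] the terms [t_n] where [n] is congruent to
    [N] modulo [2N], since [t_N = 2(2k-1)].

    For [n = mN] with [m] even and positive, a precise valuation is needed.  The
    forward expansion has no evident main term, but the backward one has.
    Extend [t] to negative indices: [t_0 = 0], [t_{-1} = 1 - 2(k-1)],
    [t_{-2} = ... = t_{-(2k-1)} = 1], [t_{-2k} = -1].  The constant sequence 1
    satisfies the same three-term recurrence, so [a_j = t_{-j} - 1] does too, and
    it is very sparse at first: [-1, -2(k-1), 0, ..., 0, -2, ...].  For even [r]
    we get [t_{-rN} - 1 = sum_i C(r, i) (-2)^i a_i], that is,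
    [t_{-rN} = 4 r (k-1) + sum_{i >= 2k} C(r, i) (-2)^i a_i].  The terms with
    [i >= 2k] have valuation larger than [v_2(4 r (k-1))], because [i]
    outweighs [v_2(i) + v_2(k-1)]; when [k = 2] and [i = 2k] this needs the
    extra factor 2 of [a_{2k}].  Hence
    [v_2(t_{-rN}) = v_2(r) + v_2(k-1) + 2].

    Finally, [2^Q N] is a period of [t] modulo a high power of 2, so negative
    indices are replaced by indices below this period: [t_n] plays the role of
    [t_{-rN}] with [r = 2^Q - m], which has the same valuation as [m]
    ([nacci_before_period], [logn2_sub_exp2]). *)

(** * Powers of 2 *)

(** The gain comes from [i C(r, i) = r C(r-1, i-1)], which gives
    [v_2(C(r, i)) >= v_2(r) - v_2(i)]. *)
Lemma dvdn_exp2_bin q c r i : (0 < i)%N -> (2 ^ q %| r)%N ->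
  (logn 2 i + c <= i)%N -> (2 ^ (q + c) %| 'C(r, i) * 2 ^ i)%N.
Proof.
move=> i_gt0 q_r le_ci.
have [i' co_i' def_i] := pfactor_coprime (isT : prime 2) i_gt0.
have q_bin : (2 ^ q %| 'C(r, i) * 2 ^ logn 2 i)%N.
  have : (2 ^ q %| i * 'C(r, i))%N.
    by case: i i_gt0 {le_ci def_i} => // i _; rewrite -mul_bin_diag dvdn_mulr.
  rewrite {1}def_i -mulnA Gauss_dvdr; first by rewrite mulnC.
  by rewrite coprimeXl.
have := dvdn_mul q_bin (dvdnn (2 ^ c)); rewrite -mulnA -!expnD => /dvdn_trans.
by apply; rewrite dvdn_mul // dvdn_exp2l.
Qed.

Lemma double_logn_lt i : (5 <= i)%N -> (2 * logn 2 i < i)%N.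
Proof.
move=> ge5i; have le_2i : (2 ^ logn 2 i <= i)%N.
  by rewrite dvdn_leq ?pfactor_dvdnn //; lia.
have [|ge3] := leqP (logn 2 i) 2; first by lia.
suff : forall l, (3 <= l)%N -> (2 * l < 2 ^ l)%N by move/(_ _ ge3); lia.
elim=> // l IHl; rewrite leq_eqVlt => /predU1P[<- //|lt3l].
by have := IHl lt3l; rewrite expnS; lia.
Qed.

Lemma logn2_sub_exp2 Q m : (0 < m)%N -> (logn 2 m < Q)%N -> (m < 2 ^ Q)%N ->
  logn 2 (2 ^ Q - m) = logn 2 m.
Proof.
move=> m_gt0 lt_mQ ltm; set q := logn 2 m in lt_mQ *.
have [m' co_m' def_m] := pfactor_coprime (isT : prime 2) m_gt0.
rewrite coprime2n in co_m'; rewrite -/q in def_m.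
have def_Q : (2 ^ Q = 2 ^ (Q - q) * 2 ^ q)%N by rewrite -expnD subnK // ltnW.
have lt_m' : (m' < 2 ^ (Q - q))%N.
  by move: ltm; rewrite {1}def_m def_Q ltn_pmul2r // expn_gt0.
rewrite {1}def_m def_Q -mulnBl lognM ?subn_gt0 ?expn_gt0 // pfactorK //.
have odd_diff : odd (2 ^ (Q - q) - m').
  by rewrite oddB ?(ltnW lt_m') // oddX co_m' subn_eq0 leqNgt lt_mQ.
by rewrite lognE dvdn2 odd_diff !andbF.
Qed.

(** * Three-term recurrences and the nacci sequence *)

Section Nacci.

Local Open Scope ring_scope.

(** The expansion of [(2 x^d - 1)^r] applied to a sequence on which the shift
    [x] satisfies [x^N = 2 x^d - 1]; the induction on [r] is Pascal's rule.  The
    recurrence is only required up to the index [M], so that the lemma also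
    applies to a sequence read backwards from the index [M]. *)
Lemma iterated_rec (N d M : nat) (a : nat -> int) : (d <= N)%N ->
    (forall n, (n + N <= M)%N -> a (n + N)%N = 2 * a (n + d)%N - a n) ->
  forall r n, (n + r * N <= M)%N ->
  a (n + r * N)%N =
    \sum_(i < r.+1) ('C(r, i) * 2 ^ i)%:Z * (-1) ^+ (r - i) * a (n + d * i)%N.
Proof.
move=> le_dN recE; elim=> [|r IHr] n le_nM.
  by rewrite big_ord1 mul0n muln0 addn0 bin0 mul1r.
have -> : (n + r.+1 * N = n + N + r * N)%N by rewrite mulSn addnA.
rewrite IHr; last by move: le_nM; rewrite mulSn addnA.
pose G i := ('C(r, i) * 2 ^ i)%:Z * (-1) ^+ (r - i) * a (n + d * i)%N.
pose H i := ('C(r, i) * 2 ^ i.+1)%:Z * (-1) ^+ (r - i) * a (n + d * i.+1)%N.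
transitivity (\sum_(i < r.+1) H i - \sum_(i < r.+1) G i).
  rewrite -sumrB; apply: eq_bigr => i _; rewrite /H /G addnAC recE; last first.
    have le_ir : (i <= r)%N by rewrite -ltnS.
    by have := leq_mul le_dN le_ir; move: le_nM; rewrite mulSn; lia.
  rewrite expnS [(n + d * i + d)%N]addnAC -addnA -mulnS !PoszM.
  by ring.
rewrite [RHS]big_ord_recl /= [X in _ = _ + X](_ : _ =
   \sum_(i < r.+1) H i - \sum_(i < r.+1) G i.+1); last first.
  rewrite -sumrB; apply: eq_bigr => i _; rewrite /H /G /bump add1n binS subSS.
  have [lt_ir|] := ltnP i r.
    by rewrite -[(r - i)%N]prednK ?subn_gt0 // -subnS exprS !PoszM PoszD; ring.
  by move=> le_ri; rewrite bin_small // !PoszM PoszD; ring.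
have -> : \sum_(i < r.+1) G i = G 0%N + \sum_(i < r.+1) G i.+1.
  rewrite big_ord_recl [in RHS]big_ord_recr /= [G r.+1]/G bin_small ?mul0n //.
  by rewrite !mul0r addr0.
by rewrite /G !bin0 !subn0 exprS; ring.
Qed.

(** A congruence modulo a power of 2 that does not divide [c] determines the
    valuation; all the finite values in the theorem are obtained in this way. *)
Lemma nu2_congr (x c q : nat) : (0 < c)%N -> (logn 2 c < q)%N ->
  ((2 ^ q)%N%:Z %| x%:Z - c%:Z)%Z -> nu2 x = (logn 2 c)%:Z%:E.
Proof.
move=> c_gt0 lt_cq; rewrite -eqz_mod_dvd !modz_nat eqz_nat => /eqP eq_xc.
have dvdE j : (j <= q)%N -> (2 ^ j %| x)%N = (j <= logn 2 c)%N.
  move=> le_jq; rewrite -pfactor_dvdn //.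
  rewrite /dvdn -(modn_dvdm x (dvdn_exp2l 2 le_jq)) eq_xc.
  by rewrite modn_dvdm // dvdn_exp2l.
have x_gt0 : (0 < x)%N.
  rewrite lt0n; apply/eqP => x0.
  by have := dvdE _ lt_cq; rewrite x0 dvdn0 ltnn.
rewrite /nu2 eqz_nat eqn0Ngt x_gt0 /=; congr (_%:Z%:E); apply/eqP.
rewrite eqn_leq leqNgt -!pfactor_dvdn // !dvdE ?(ltnW lt_cq) //.
by rewrite ltnn leqnn.
Qed.

Variables (k : nat) (hk : (2 <= k)%N).

Local Notation T n := (nacci k n)%:Z.

Lemma nacci_double : nacci k (2 * k) = (2 * k - 1)%N.
Proof.
rewrite nacci_rec //; last by lia.
rewrite big_nat_recr /=; last by lia.
rewrite subnn nacci0 addn0 (eq_big_nat _ _ (F2 := fun=> 1%N)) => [|i lt_i].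
  by rewrite sum_nat_const_nat muln1.
by rewrite nacci1 //; lia.
Qed.

Lemma nacci_shift n :
  T (n + (2 * k + 1)) = 2 * T (n + 2 * k) - T n.
Proof.
suff : (nacci k (n + (2 * k + 1)) + nacci k n = 2 * nacci k (n + 2 * k))%N.
  by lia.
rewrite nacci_rec; [|lia..].
rewrite big_nat_recl; last by lia.
have -> : (n + (2 * k + 1) - 1 = n + 2 * k)%N by lia.
rewrite -addnA [RHS]mul2n -[RHS]addnn; congr (_ + _)%N.
rewrite [RHS]nacci_rec; [|lia..].
rewrite big_nat_recr /=; last by lia.
by rewrite addnK; congr (_ + _)%N; apply: eq_big_nat => i _; congr nacci; lia.
Qed.

(** In the expansion of [(2 x^{2k} - 1)^r] every term but [(-1)^r] is divisible
    by [2^(q+1)], because [v_2(i) < i] for [i > 0]. *)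
Lemma nacci_iter_congr q r n : (2 ^ q %| r)%N ->
  ((2 ^ q.+1)%N%:Z %| T (n + r * (2 * k + 1)) - (-1) ^+ r * T n)%Z.
Proof.
move=> q_r; pose M := (n + r * (2 * k + 1))%N.
rewrite (iterated_rec (d := 2 * k) (M := M) (a := fun n => T n)) //; first last.
- by move=> m _; apply: nacci_shift.
- by rewrite leq_addr.
rewrite big_ord_recl /= bin0 muln0 addn0 subn0 mul1r addrAC subrr add0r.
apply: rpred_sum => i _; rewrite -mulrA dvdz_mulr // dvdzE !absz_nat.
by rewrite -[q.+1]addn1 dvdn_exp2_bin // addn1 ltn_logl.
Qed.

(** The backward expansion, with [4 r (k-1)] as its main term: its valuation is
    [v_2(r) + v_2(k-1) + 2], one less than the exponent of the modulus, when
    [2^q] is the exact power of 2 in [r].  The index [2^Q N] stands for 0, and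
    [Q] is taken large enough for [2^Q N] to be a period of the sequence for
    this modulus. *)
Lemma nacci_before_period q Q r n : (0 < r)%N -> ~~ odd r -> (2 ^ q %| r)%N ->
    (n + r * (2 * k + 1) = 2 ^ Q * (2 * k + 1))%N ->
    (q + logn 2 (k - 1) + 2 <= Q)%N ->
  ((2 ^ (q + logn 2 (k - 1) + 3))%N%:Z %| T n - (4 * r * (k - 1))%N%:Z)%Z.
Proof.
move=> r_gt0 even_r q_r def_n le_Q; set N := (2 * k + 1)%N.
set v := logn 2 (k - 1) in le_Q *; set d := Posz (2 ^ _).
pose P := (2 ^ Q * N)%N; pose a j := T (P - j) - 1.
have lt_vk : (v < k - 1)%N by rewrite /v ltn_logl //; lia.
have periodP m : (d %| T (m + P) - T m)%Z.
  have := nacci_iter_congr m (dvdnn (2 ^ Q)).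
  rewrite -signr_odd oddX /= orbF eqn0Ngt (_ : 0 < Q)%N; last by lia.
  rewrite mul1r; apply: dvdz_trans; rewrite dvdzE !absz_nat dvdn_exp2l //; lia.
have ltQ : (N <= P)%N by rewrite /P leq_pmull // expn_gt0.
(* The recurrence leads below the period, where the values at and above [P]
   are replaced by those at the start of the sequence. *)
have backP j : (0 < j <= 2 * k)%N ->
    (d %| T (P - j) - (2 * T (2 * k - j) - T (N - j)))%Z.
  move=> /andP[j_gt0 le_j].
  have := nacci_shift (P - j); rewrite -/N.
  have -> : (P - j + N = N - j + P)%N by lia.
  have -> : (P - j + 2 * k = 2 * k - j + P)%N by lia.
  move=> shiftE.
  have -> : T (P - j) - (2 * T (2 * k - j) - T (N - j)) =
     2 * (T (2 * k - j + P) - T (2 * k - j)) - (T (N - j + P) - T (N - j)).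
    by lia.
  by rewrite rpredB ?dvdz_mull.
(* Modulo [d], the sequence [a] starts as -1, -2(k-1), 0, ..., 0, -2. *)
have a0 : (d %| a 0%N + 1)%Z.
  by have := periodP 0%N; rewrite add0n nacci0 subr0 /a subn0 subrK.
have a1 : (d %| a 1%N - (2 - 2 * k%:Z))%Z.
  have /backP : (0 < 1 <= 2 * k)%N by lia.
  rewrite /N addnK nacci_double (@nacci1 k (2 * k - 1)); last by lia.
  by rewrite /a => h; apply: etrans h; congr (_ %| _)%Z; lia.
have a_mid j : (2 <= j < 2 * k)%N -> (d %| a j)%Z.
  move=> lt_j; have /backP : (0 < j <= 2 * k)%N by lia.
  rewrite (@nacci1 k (2 * k - j)) ?(@nacci1 k (N - j)); [|rewrite /N; lia..].
  by rewrite /a => h; apply: etrans h; congr (_ %| _)%Z; lia.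
have a_last : (2 %| a (2 * k)%N)%Z.
  have /backP : (0 < (2 * k) <= 2 * k)%N by lia.
  rewrite subnn nacci0 (@nacci1 k (N - 2 * k)); last by rewrite /N; lia.
  have /dvdz_trans dvd2 : (2 %| d)%Z.
    by rewrite /d dvdzE !absz_nat (@dvdn_exp2l 2 1) //; lia.
  by move=> /dvd2; rewrite /a; lia.
have recP m : (m + N <= P)%N -> a (m + N)%N = 2 * a (m + 1)%N - a m.
  move=> le_m; have := nacci_shift (P - (m + N)); rewrite -/N /a.
  have -> : (P - (m + N) + N = P - m)%N by lia.
  have -> : (P - (m + N) + 2 * k = P - (m + 1))%N by lia.
  by lia.
have def_a : a (0 + r * N)%N = T n - 1.
  by rewrite /a add0n /P -def_n addnK.
have le_rP : (0 + r * N <= P)%N by rewrite add0n /P -def_n leq_addl.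
have := iterated_rec (_ : 1 <= N)%N recP le_rP.
rewrite def_a => /(_ ltac:(lia)).
case: r r_gt0 even_r q_r {def_n def_a le_rP} => // r _ even_r q_r.
rewrite !big_ord_recl /= bin0 bin1 subSS !subn0 expn0 expn1 muln0 muln1 !add0n.
rewrite -signr_odd (negbTE even_r) -[(-1) ^+ r]signr_odd.
rewrite -[odd r]negbK even_r /=.
set S := \sum_(i < _) _ => eqT.
have -> : T n - (4 * r.+1 * (k - 1))%N%:Z =
    (a 0%N + 1) - 2 * r.+1%:Z * (a 1%N - (2 - 2 * k%:Z)) + S.
  have -> : T n = T n - 1 + 1 by lia.
  by rewrite eqT !PoszM -subzn; [ring|lia].
(* The first two summands are multiples of [d]; [S] collects the indices
   [i >= 2] of the expansion. *)
rewrite rpredD // ?rpredB ?dvdz_mull //.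
rewrite /S {S eqT}; apply: rpred_sum => i _; rewrite /bump /= !add1n mul1n add0n.
set j := i.+2.
case: (ltngtP j (2 * k)) => [lt_j|gt_j|eq_j].
- by rewrite dvdz_mull // a_mid.
- rewrite dvdz_mulr // dvdz_mulr // dvdzE !absz_nat -addnA dvdn_exp2_bin //.
  by have := @double_logn_lt j; lia.
(* Here one factor 2 of the modulus comes from [a (2 * k)], and the binomial
   term provides the rest. *)
- rewrite mulrAC dvdz_mulr // eq_j.
  have -> : d = (2 ^ (q + (v + 2)))%N%:Z * 2.
    by rewrite /d -PoszM -expnSr; congr (Posz (2 ^ _)); lia.
  rewrite dvdz_mul // dvdzE !absz_nat dvdn_exp2_bin //; first by lia.
  rewrite lognM //; last by lia.
  have : (logn 2 k < k)%N by rewrite ltn_logl //; lia.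
  by rewrite (logn_prime _ (isT : prime 2)) //=; lia.
Qed.

End Nacci.

(** * The valuation *)

Theorem theorem3 (k : nat) (hk : (2 <= k)%N) (n : nat) :
  [/\ (forall i : nat, (1 <= i <= 2 * k)%N -> n = i %[mod 2 * k + 1] ->
         nu2 (nacci k n)%:Z = 0%:Z%:E),
      (n = 2 * k + 1 %[mod 2 * (2 * k + 1)] ->
         nu2 (nacci k n)%:Z = 1%:Z%:E) &
      (n = 0 %[mod 2 * (2 * k + 1)] ->
         nu2 (nacci k n)%:Z = (nu2 n%:Z + nu2 (k%:Z - 1)%R + 2%:Z%:E)%E)].
Proof.
split=> [i le_i eq_ni|eq_n|eq_n].
- have def_n : n = i + n %/ (2 * k + 1) * (2 * k + 1).
    rewrite {1}(divn_eq n (2 * k + 1)) eq_ni modn_small; first by rewrite addnC.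
    by lia.
  have odd_i : odd (nacci k i).
    have [lt_i|eq_i] : i < 2 * k \/ i = 2 * k by lia.
      by rewrite nacci1 //; lia.
    by rewrite eq_i nacci_double //; lia.
  apply: (@nu2_congr _ 1 1) => //.
  have := nacci_iter_congr hk i (dvd1n (n %/ (2 * k + 1)) : 2 ^ 0 %| _).
  rewrite -def_n -signr_odd; case: (odd _) => /=; rewrite ?expr0 ?expr1; lia.
- have def_n : n = (2 * k + 1) + 2 * (n %/ (2 * (2 * k + 1))) * (2 * k + 1).
    rewrite {1}(divn_eq n (2 * (2 * k + 1))) eq_n modn_small; last by lia.
    by rewrite addnC mulnCA mulnA.
  apply: (@nu2_congr _ 2 2) => //.
  have := nacci_iter_congr hk (2 * k + 1)
            (dvdn_mulr (n %/ (2 * (2 * k + 1))) (dvdnn 2) : 2 ^ 1 %| _).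
  rewrite -def_n -signr_odd oddM /= expr0 mul1r.
  have := nacci_shift hk 0; rewrite !add0n nacci0 nacci_double //; lia.
- have k1E : (k%:Z - 1 = (k - 1)%N%:Z)%R by lia.
  have nu2k : nu2 (k%:Z - 1)%R = (logn 2 (k - 1))%:Z%:E.
    by rewrite k1E /nu2 eqz_nat ifN //; lia.
  (* At [n = 0] both sides are infinite. *)
  rewrite nu2k; have [->|n_gt0] := posnP n; first by rewrite nacci0.
  set N := (2 * k + 1) in eq_n; set m := 2 * (n %/ (2 * N)).
  have def_n : n = m * N.
    by rewrite {1}(divn_eq n (2 * N)) eq_n mod0n addn0 mulnCA mulnA.
  have m_gt0 : 0 < m by move: n_gt0; rewrite def_n; case: (m).
  (* Large enough for [m < 2 ^ Q] and for the bound on [Q] in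
     [nacci_before_period]. *)
  pose Q := m + logn 2 (k - 1) + 2.
  have lt_m : m < 2 ^ Q by apply: leq_ltn_trans (ltn_expl Q _); rewrite // /Q; lia.
  have lt_qm : logn 2 m < m by rewrite ltn_logl.
  have log_r : logn 2 (2 ^ Q - m) = logn 2 m.
    by rewrite logn2_sub_exp2 //; rewrite /Q; lia.
  have log_n : logn 2 n = logn 2 m.
    rewrite def_n lognM // /N; last by lia.
    by rewrite [X in _ + X]lognE dvdn2 oddD oddM /= andbF addn0.
  have even_r : ~~ odd (2 ^ Q - m).
    by rewrite oddB ?(ltnW lt_m) // oddX oddM /= /Q !addnS.
  have := @nacci_before_period _ hk (logn 2 m) Q (2 ^ Q - m) n.
  rewrite even_r subn_gt0 lt_m -{1}log_r pfactor_dvdnn => /(_ isT isT isT).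
  rewrite -/N {1}def_n -mulnDl subnKC ?(ltnW lt_m) // => /(_ erefl).
  move=> /(_ ltac:(rewrite /Q; lia)) congr_n.
  have [r_gt0 k1_gt0] : 0 < 2 ^ Q - m /\ 0 < k - 1 by lia.
  set c := 4 * (2 ^ Q - m) * (k - 1) in congr_n.
  have log_c : logn 2 c = logn 2 m + logn 2 (k - 1) + 2.
    rewrite /c (lognM 2 (m := 4 * _)) ?(lognM 2 (m := 4)) ?muln_gt0 ?r_gt0 // log_r.
    by rewrite (pfactorK 2 (isT : prime 2)); lia.
  rewrite (nu2_congr _ _ congr_n) ?log_c; first last.
  - by lia.
  - by rewrite /c !muln_gt0 r_gt0 k1_gt0.
  rewrite /nu2 eqz_nat eqn0Ngt n_gt0 /= log_n.
  by rewrite -!EFinD -!PoszD.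
Qed.
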